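(* Let $A$ be a locally compact, totally disconnected abelian topological group whose Pontryagin dual $\widehat{A}$ is also locally compact and totally disconnected, let $H$ be a locally compact, totally disconnected group acting continuously on $A$ by automorphisms via $t$, and let $G=H\times_tA$. Let $\pi_1$ and $\pi_2$ be smooth representations of $A$ and $H$ respectively on the same vector space $V$, and let $P$ be the cosmooth projection valued measure on $\widehat{A}$ corresponding to $\pi_1$. Then there exists a smooth representation $\pi$ of $G$ on $V$ whose restrictions to $A$ and $H$ are $\pi_1$ and $\pi_2$ respectively if and only if $(\pi_2,P;V)$ is a cosmooth system of imprimitivity for $H$ based on $\widehat{A}$. In this case, $\pi$ is unique.
   Context: All vector spaces are complex. A representation of a locally compact totally disconnected group is smooth if every vector is fixed by some compact open subgroup. Write $h[a]=t_h(a)$; the action map $H\times A\to A$ is continuous. $G=H\times_tA$ is $H\times A$ with the product topology and multiplication $(h,a)(h',a')=(hh',a\,t_h(a'))$; $H$ and $A$ are identified with the subgroups $\{(h,e_A)\}$ and $\{(e_H,a)\}$, so $hah^{-1}=h[a]$. $H$ acts continuously on $\widehat{A}$ (continuous unitary characters, compact-open topology) by $(h[\widehat{a}])(a)=\widehat{a}(h^{-1}[a])$. A projection valued measure $P$ based on $\widehat{A}$, acting on $V$, assigns to each open and closed subset $E\subseteq\widehat{A}$ a linear operator $P_E$ on $V$ such that: (i) $P_{\widehat{A}}=\mathrm{I}$, $P_{\emptyset}=0$; (ii) $P_EP_F=P_{E\cap F}$; (iii) $P_{\bigcup E_i}=\sum P_{E_i}$ for pairwise disjoint $E_i$ (equality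 after applying to each vector). It is cosmooth if for every $v\in V$ there is a compact open $E(v)\subseteq\widehat{A}$ with $P_Ev=P_{E\cap E(v)}v$ for all $E$. The cosmooth projection valued measure corresponding to a smooth representation $\pi_1$ of $A$ on $V$ is the unique cosmooth $P$ such that $\pi_1(a)v=\int_{E(v)}x(a)\,dP(x)v$ for all $a\in A$, $v\in V$, where for $f$ locally constant on a compact open set $E=\bigsqcup_{i=1}^nE_i$, with $E_i$ compact open and $f=c_i$ on $E_i$, $\int_Ef\,dP\,v=\sum_ic_iP_{E_i}v$. A cosmooth system of imprimitivity for $H$ based on $\widehat{A}$, acting on $V$, is a triple $(\pi_2,P;V)$ with $\pi_2$ a smooth representation of $H$ on $V$ and $P$ a cosmooth projection valued measure based on $\widehat{A}$ acting on $V$ such that $\pi_2(h)P_E\pi_2(h)^{-1}=P_{h[E]}$ for all $h\in H$ and all open and closed $E\subseteq\widehat{A}$. *)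

(* Defs.v *)
From HB Require Import structures.
From mathcomp Require Import all_boot all_order all_algebra.
From mathcomp Require Import all_classical all_reals all_analysis.
From mathcomp Require Import complex.
Set Implicit Arguments.
Unset Strict Implicit.
Unset Printing Implicit Defensive.
Import Order.TTheory GRing.Theory Num.Theory.
Import numFieldNormedType.Exports.
Local Open Scope classical_set_scope.
Local Open Scope ring_scope.

(* The complex numbers over R, typed so that the topology of the modulus is
   inferred. *)
Definition cplx (R : realType) : numClosedFieldType := R[i].

(* Topological groups, written multiplicatively; neither commutative nor
   Hausdorff in general (a totally disconnected one is Hausdorff). *)
HB.mixin Record isTopologicalGroup G of Topological G & Group G := {
  mulg_continuous : continuous (fun xy : G * G => (xy.1 * xy.2)%g);
  invg_continuous : continuous (fun x : G => (x^-1)%g)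
}.

#[short(type="topologicalGroupType")]
HB.structure Definition TopologicalGroup :=
  {G of Topological G & Group G & isTopologicalGroup G}.

Definition is_subgroup (G : groupType) (K : set G) : Prop :=
  [/\ K 1%g, forall x y, K x -> K y -> K (x * y)%g
    & forall x, K x -> K (x^-1)%g].

(* Continuous actions of H on A by automorphisms; continuity is joint. *)
Record autAction (H A : topologicalGroupType) := AutAction {
  aact :> H -> A -> A;
  aact1 : forall a, aact 1%g a = a;
  aactM : forall h h' a, aact (h * h')%g a = aact h (aact h' a);
  aact_morphM : forall h a b, aact h (a * b)%g = (aact h a * aact h b)%g;
  aact_continuous : continuous (fun ha : H * A => aact ha.1 ha.2)
}.

Section ActionTheory.
Variables (H A : topologicalGroupType) (t : autAction H A).

Lemma aact_continuous_r h : continuous (t h).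
Proof.
move=> a; apply: (@continuous_comp _ _ _ (fun b => (h, b))
  (fun ha : H * A => t ha.1 ha.2)); last exact: aact_continuous.
by apply: cvg_pair; [exact: cvg_cst|exact: cvg_id].
Qed.

Lemma aact_morph1 h : t h 1%g = 1%g.
Proof.
by apply: (@mulgI _ (t h 1%g)); rewrite -aact_morphM !mulg1.
Qed.

End ActionTheory.

Definition semidirect (H A : topologicalGroupType) (t : autAction H A) : Type :=
  (H * A)%type.

Section Semidirect.
Variables (H A : topologicalGroupType) (t : autAction H A).
Local Notation G := (semidirect t).

HB.instance Definition _ := Topological.copy G (H * A)%type.

Definition semidirect_mul (x y : G) : G :=
  ((x.1 * y.1)%g, (x.2 * t x.1 y.2)%g).
Definition semidirect_one : G := (1%g, 1%g).
Definition semidirect_inv (x : G) : G :=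
  ((x.1^-1)%g, t (x.1^-1)%g (x.2^-1)%g).

Lemma semidirect_mulA : associative semidirect_mul.
Proof.
move=> [h a] [h' a'] [h'' a'']; rewrite /semidirect_mul /=.
by rewrite aact_morphM aactM !mulgA.
Qed.

Lemma semidirect_mul1 : left_id semidirect_one semidirect_mul.
Proof. by move=> [h a]; rewrite /semidirect_mul /= aact1 !mul1g. Qed.

Lemma semidirect_mulr1 : right_id semidirect_one semidirect_mul.
Proof. by move=> [h a]; rewrite /semidirect_mul /= aact_morph1 !mulg1. Qed.

Lemma semidirect_mulV :
  left_inverse semidirect_one semidirect_inv semidirect_mul.
Proof.
by move=> [h a]; rewrite /semidirect_mul /= -aact_morphM !mulVg aact_morph1.
Qed.

Lemma semidirect_mulrV :
  right_inverse semidirect_one semidirect_inv semidirect_mul.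
Proof.
by move=> [h a]; rewrite /semidirect_mul /= -aactM !mulgV aact1 mulgV.
Qed.

HB.instance Definition _ := isGroup.Build G semidirect_mulA semidirect_mul1
  semidirect_mulr1 semidirect_mulV semidirect_mulrV.

Let fst_cts : continuous (fun x : G => x.1).
Proof. by move=> x; exact: cvg_fst. Qed.

Let snd_cts : continuous (fun x : G => x.2).
Proof. by move=> x; exact: cvg_snd. Qed.

Let pair_cts (U : topologicalType) (f : U -> H) (g : U -> A) :
  continuous f -> continuous g -> continuous (fun u => (f u, g u) : G).
Proof.
move=> cf cg; rewrite -[continuous _]/(continuous (fun u => (f u, g u))) => u.
by apply: cvg_pair; [exact: cf|exact: cg].
Qed.

Let mulg_cts (U : topologicalType) (L : topologicalGroupType)
  (f g : U -> L) : continuous f -> continuous g ->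
  continuous (fun u => (f u * g u)%g).
Proof.
move=> cf cg u; apply: (@continuous_comp _ _ _ (fun v => (f v, g v))
  (fun xy : L * L => (xy.1 * xy.2)%g)); last exact: mulg_continuous.
by apply: cvg_pair; [exact: cf|exact: cg].
Qed.

Let aact_cts (U : topologicalType) (f : U -> H) (g : U -> A) :
  continuous f -> continuous g -> continuous (fun u => t (f u) (g u)).
Proof.
move=> cf cg u; apply: (@continuous_comp _ _ _ (fun v => (f v, g v))
  (fun ha : H * A => t ha.1 ha.2)); last exact: aact_continuous.
by apply: cvg_pair; [exact: cf|exact: cg].
Qed.

Lemma semidirect_mul_continuous :
  continuous (fun xy : G * G => (xy.1 * xy.2)%g).
Proof.
have c11 : continuous (fun xy : G * G => xy.1.1).
  move=> xy; apply: (@continuous_comp _ _ _ fst (fun x : G => x.1)).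
    exact: cvg_fst.
  exact: fst_cts.
have c12 : continuous (fun xy : G * G => xy.1.2).
  move=> xy; apply: (@continuous_comp _ _ _ fst (fun x : G => x.2)).
    exact: cvg_fst.
  exact: snd_cts.
have c21 : continuous (fun xy : G * G => xy.2.1).
  move=> xy; apply: (@continuous_comp _ _ _ snd (fun x : G => x.1)).
    exact: cvg_snd.
  exact: fst_cts.
have c22 : continuous (fun xy : G * G => xy.2.2).
  move=> xy; apply: (@continuous_comp _ _ _ snd (fun x : G => x.2)).
    exact: cvg_snd.
  exact: snd_cts.
apply: (@pair_cts _ (fun z : G * G => (z.1.1 * z.2.1)%g)
  (fun z : G * G => (z.1.2 * t z.1.1 z.2.2)%g)); first exact: mulg_cts.
by apply: mulg_cts => //; exact: aact_cts.
Qed.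

Lemma semidirect_inv_continuous : continuous (fun x : G => (x^-1)%g).
Proof.
have c1 : continuous (fun x : G => (x.1^-1)%g).
  move=> x; apply: (@continuous_comp _ _ _ (fun x : G => x.1)
    (fun h : H => (h^-1)%g)); [exact: fst_cts|exact: invg_continuous].
have c2 : continuous (fun x : G => (x.2^-1)%g).
  move=> x; apply: (@continuous_comp _ _ _ (fun x : G => x.2)
    (fun a : A => (a^-1)%g)); [exact: snd_cts|exact: invg_continuous].
apply: (@pair_cts _ (fun z : G => (z.1^-1)%g)
  (fun z : G => t (z.1^-1)%g (z.2^-1)%g)); first exact: c1.
exact: aact_cts.
Qed.

HB.instance Definition _ := isTopologicalGroup.Build G
  semidirect_mul_continuous semidirect_inv_continuous.

Definition semidirect_inl (h : H) : G := (h, 1%g).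
Definition semidirect_inr (a : A) : G := (1%g, a).

End Semidirect.

(* The Pontryagin dual, with the subspace topology induced by the compact-open
   topology; its group structure is not used. *)
Record dual (R : realType) (A : topologicalGroupType) := Dual {
  dual_fun :> A -> cplx R;
  dualM : forall a b, dual_fun (a * b)%g = dual_fun a * dual_fun b;
  dual_norm : forall a, `|dual_fun a| = 1;
  dual_continuous : continuous dual_fun
}.

HB.instance Definition _ (R : realType) (A : topologicalGroupType) :=
  gen_eqMixin (dual R A).
HB.instance Definition _ (R : realType) (A : topologicalGroupType) :=
  gen_choiceMixin (dual R A).
HB.instance Definition _ (R : realType) (A : topologicalGroupType) :=
  Topological.copy (dual R A)
    (initial_topology
       (fun x : dual R A => dual_fun x : {compact-open, A -> cplx R})).

Section DualAction.
Variables (R : realType) (H A : topologicalGroupType) (t : autAction H A).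
Variables (h : H) (x : dual R A).

Let f (a : A) : cplx R := x (t (h^-1)%g a).

Let fM a b : f (a * b)%g = f a * f b.
Proof. by rewrite /f aact_morphM dualM. Qed.

Let f_norm a : `|f a| = 1.
Proof. exact: dual_norm. Qed.

Let f_continuous : continuous f.
Proof.
move=> a; apply: (@continuous_comp _ _ _ (t (h^-1)%g) x).
  exact: aact_continuous_r.
exact: dual_continuous.
Qed.

Definition dual_act : dual R A := Dual fM f_norm f_continuous.

End DualAction.

Section SmoothRep.
Variables (R : realType) (G : topologicalGroupType) (V : lmodType (cplx R)).

Definition is_rep (pi : G -> V -> V) : Prop :=
  [/\ forall g, linear (pi g), forall v, pi 1%g v = v
    & forall g g' v, pi (g * g')%g v = pi g (pi g' v)].

Definition smooth_rep (pi : G -> V -> V) : Prop :=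
  is_rep pi /\
  forall v, exists K : set G,
    [/\ is_subgroup K, compact K, open K & forall g, K g -> pi g v = v].

End SmoothRep.

Section PVM.
Variables (R : realType) (X : topologicalType) (V : lmodType (cplx R)).
Implicit Types (P : set X -> V -> V) (E F : set X) (v : V).

(* P is a total function on sets, but only its values on clopen sets are
   constrained and used.  In the additivity clause the family is arbitrary,
   provided its union is clopen; V carries no topology, so the sum
   \sum_i P_{E_i} v is one with finitely many nonzero terms. *)
Definition is_pvm P : Prop :=
  [/\ forall E, clopen E -> linear (P E),
      forall v, P setT v = v,
      forall v, P set0 v = 0,
      forall E F v, clopen E -> clopen F -> P E (P F v) = P (E `&` F) v
    & forall (I : choiceType) (E : I -> set X),
        (forall i, clopen (E i)) -> trivIset setT E ->
        clopen (\bigcup_i E i) ->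
        forall v, finite_set [set i | P (E i) v != 0] /\
          P (\bigcup_i E i) v = \sum_(i \in [set: I]) P (E i) v].

(* F is an admissible choice of E(v). *)
Definition pvm_supported P v F : Prop :=
  [/\ compact F, open F & forall E, clopen E -> P E v = P (E `&` F) v].

Definition cosmooth P : Prop := forall v, exists F, pvm_supported P v F.

(* pvm_integral P F f v w : f is locally constant on the compact open set F,
   and w is the integral of f over F against dP v.  The value w does not
   depend on the partition when P is a projection valued measure. *)
Definition pvm_integral P F (f : X -> cplx R) v (w : V) : Prop :=
  exists n (E : 'I_n -> set X) (c : 'I_n -> cplx R),
    [/\ forall i, compact (E i) /\ open (E i),
        trivIset setT E,
        \bigcup_i E i = F,
        forall i x, E i x -> f x = c i
      & w = \sum_(i < n) c i *: P (E i) v].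

End PVM.

(* F plays the role of E(v); the integrand is the evaluation x |-> x(a). *)
Definition corresponding_pvm (R : realType) (A : topologicalGroupType)
    (V : lmodType (cplx R)) (pi1 : A -> V -> V)
    (P : set (dual R A) -> V -> V) : Prop :=
  [/\ is_pvm P, cosmooth P
    & forall v, exists2 F, pvm_supported P v F &
        forall a, pvm_integral P F (fun x => x a) v (pi1 a v)].

Definition cosmooth_imprimitivity (R : realType) (H A : topologicalGroupType)
    (t : autAction H A) (V : lmodType (cplx R)) (pi2 : H -> V -> V)
    (P : set (dual R A) -> V -> V) : Prop :=
  [/\ smooth_rep pi2, is_pvm P, cosmooth P
    & forall h E v, clopen E ->
        pi2 h (P E (pi2 (h^-1)%g v)) = P (dual_act t h @` E) v].

Definition smooth_extension (R : realType) (H A : topologicalGroupType)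
    (t : autAction H A) (V : lmodType (cplx R)) (pi1 : A -> V -> V)
    (pi2 : H -> V -> V) (pi : semidirect t -> V -> V) : Prop :=
  [/\ smooth_rep pi, forall a, pi (semidirect_inr t a) = pi1 a
    & forall h, pi (semidirect_inl t h) = pi2 h].

(* Main.v *)
From HB Require Import structures.
Require Import Defs.
From mathcomp Require Import all_boot all_order all_algebra.
From mathcomp Require Import all_classical all_reals all_analysis.
From mathcomp Require Import complex.
Set Implicit Arguments.
Unset Strict Implicit.
Unset Printing Implicit Defensive.
Local Open Scope classical_set_scope.
Local Open Scope ring_scope.
Import Order.TTheory GRing.Theory Num.Theory.
Import numFieldNormedType.Exports.

(** Both conditions on [pi1], [pi2] and [P] are equivalent to the intertwining
    relation

      [pi2 h (pi1 a v) = pi1 (t h a) (pi2 h v)].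

    For the extension problem this is algebra: every element of the semidirect
    product is [a * h], so [pi] has to be [pi1 a \o pi2 h], and the relation
    says that this is multiplicative. Smoothness needs a compact open subgroup
    of the semidirect product below the product of a compact open subgroup [K]
    of [H] and one [L] of [A]; the elements of [K] that preserve [L] form an
    open subgroup because [L] is compact.

    For the system of imprimitivity, the link between [pi1] and [P] is that
    [P S v] is an eigenvector of [pi1 a], of eigenvalue [c], as soon as all
    the characters in the clopen set [S] take the value [c] at [a]
    ([rep_pvm_eigen]), and that for given [v] and [a] the vector [v] is a
    finite sum of such eigenvectors ([spectral_decomposition]).

    If [P] is covariant, then [pi2 h] sends the [c]-eigenvector [P S v] of
    [pi1 a] to [P (h S) (pi2 h v)], a [c]-eigenvector of [pi1 (t h a)], since
    the characters in [h S] take the value [c] at [t h a]. Summing over the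
    spectral decomposition of [v] gives the relation
    ([imprimitivity_intertwines]).

    Conversely, assume the relation. Covariance of [P] follows once
    [P D (pi2 h (P E v)) = 0] whenever [D] and [h E] are disjoint
    ([intertwiner_disjoint]): for a character [x] in [E] and [y] in [D] some
    [a] satisfies [x a <> y (t h a)]; on small clopen neighbourhoods [E1] of
    [x] and [D1] of [y] the vector [pi2 h (P E1 v)] is an [x a]-eigenvector of
    [pi1 (t h a)], which [P D1] kills because it commutes with [pi1 (t h a)]
    and its range consists of eigenvectors for another eigenvalue. As [P] is
    cosmooth, only compact parts of [E] and [D] matter, and finitely many
    neighbourhoods suffice. For trivial [h] and two measures attached to
    [pi1], the same argument gives the uniqueness of the corresponding
    projection valued measure. *)

(** * Compactness and linearity preliminaries *)

(** A form of compactness suited to properties that are closed under finite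
    unions: a local property then holds on a set containing [C]. The
    complements in [C] of the members of [Q] generate a filter; were it
    proper, it would cluster at a point of [C], which contradicts the member
    of [Q] around that point. *)
Lemma compact_cover_ind (X : topologicalType) (C : set X) (Q : set X -> Prop) :
  compact C -> Q set0 -> (forall M N, Q M -> Q N -> Q (M `|` N)) ->
  (forall x, C x -> exists2 N, Q N & nbhs x N) ->
  exists2 N, Q N & C `<=` N.
Proof.
move=> Cc Q0 QU Qloc; apply: contrapT => noN.
pose FF : set_system X := [set S | exists2 N, Q N & C `\` N `<=` S].
have FFp : ProperFilter FF.
  split.
    move=> [N QN CN]; apply: noN; exists N => // x Cx.
    by apply: contrapT => nNx; exact: (CN x).
  split.
  - by exists set0.
  - move=> S S' [N QN NS] [N' QN' NS']; exists (N `|` N'); first exact: QU.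
    by move=> x [Cx /not_orP[nN nN']]; split; [exact: NS|exact: NS'].
  - by move=> S S' SS' [N QN NS]; exists N => //; exact: subset_trans SS'.
have [|x [Cx clx]] := Cc FF FFp; first by exists set0 => // x [].
have [N QN Nx] := Qloc x Cx.
have FN : FF (C `\` N) by exists N.
by have [y [[_ nNy] Ny]] := clx _ _ FN Nx.
Qed.

(** Turns the unbundled linearity of representations and projections into an
    instance to which the theory of linear maps applies. *)
Lemma linear_bundle (K : nzRingType) (U V : lmodType K) (f : U -> V) :
  linear f -> exists g : {linear U -> V}, f = g.
Proof.
move=> lf.
by exists (HB.pack f (GRing.isLinear.Build K U V *:%R f lf) : {linear U -> V}).
Qed.

Lemma clopenD (X : topologicalType) (E F : set X) :
  clopen E -> clopen F -> clopen (E `\` F).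
Proof. by move=> cE cF; rewrite setDE; apply: clopenI; [|exact: clopenC]. Qed.

(** * Finite additivity of projection valued measures *)

Lemma pvm_finite_additivity (R : realType) (X : topologicalType)
    (V : lmodType (cplx R)) (P : set X -> V -> V) (I : finType)
    (E : I -> set X) (v : V) :
  is_pvm P -> (forall i, clopen (E i)) -> trivIset setT E ->
  clopen (\bigcup_i E i) -> P (\bigcup_i E i) v = \sum_i P (E i) v.
Proof.
move=> [_ _ _ _ Padd] cE tE cU; have [_ ->] := Padd _ _ cE tE cU v.
rewrite (fsbigE (index_enum I)) ?index_enum_uniq //=.
- by apply: eq_bigl => i; rewrite in_setT.
- by move=> i _; rewrite mem_index_enum.
Qed.

Lemma pvm_setID (R : realType) (X : topologicalType) (V : lmodType (cplx R))
    (P : set X -> V -> V) (S N : set X) (v : V) :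
  is_pvm P -> clopen S -> clopen N ->
  P S v = P (S `&` N) v + P (S `\` N) v.
Proof.
move=> pP cS cN.
pose E (b : bool) := if b then S `&` N else S `\` N.
have UE : \bigcup_b E b = S.
  apply/seteqP; split=> [x [[] _ []]//|x Sx].
  by have [Nx|nNx] := pselect (N x); [exists true|exists false].
rewrite -{1}UE pvm_finite_additivity ?UE //.
- by rewrite big_bool.
- by case; [exact: clopenI|exact: clopenD].
- by apply/trivIsetP => -[] [] _ _ // _; apply/seteqP; split=> x // [[? ?] []].
Qed.

Lemma pvm_vanishS (R : realType) (X : topologicalType) (V : lmodType (cplx R))
    (P : set X -> V -> V) (S N : set X) (v : V) :
  is_pvm P -> clopen S -> clopen N -> S `<=` N -> P N v = 0 -> P S v = 0.
Proof.
move=> [Plin _ _ PI _] cS cN SN PN.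
rewrite -(setIidl SN) -PI // PN.
by have [g ->] := linear_bundle (Plin _ cS); rewrite linear0.
Qed.

Lemma pvm_vanishU (R : realType) (X : topologicalType) (V : lmodType (cplx R))
    (P : set X -> V -> V) (M N : set X) (v : V) :
  is_pvm P -> clopen M -> clopen N -> P M v = 0 -> P N v = 0 ->
  P (M `|` N) v = 0.
Proof.
move=> pP cM cN PM PN; have cMN := clopenU cM cN.
rewrite (pvm_setID v pP cMN cM).
rewrite (pvm_vanishS pP (clopenI cMN cM) cM _ PM) ?add0r; last by move=> x [].
by rewrite (pvm_vanishS pP (clopenD cMN cM) cN _ PN) // => x [[]].
Qed.

(** * The dual group as a topological space *)

(** Singletons are compact, so the compact-open topology refines the pointwise
    one. *)
Lemma eval_continuous (R : realType) (A : topologicalGroupType) (a : A) :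
  continuous (fun x : dual R A => x a : cplx R).
Proof.
apply/continuousP => O oO.
exists [set f : {compact-open, A -> cplx R} | f @` [set a] `<=` O].
  exact: (compact_open_open (@compact_set1 _ a) oO).
apply/seteqP; split=> x /=.
- by apply; exists a.
- by move=> Ox _ [_ -> <-].
Qed.

Lemma dual_ext (R : realType) (A : topologicalGroupType) (x y : dual R A) :
  (forall a, x a = y a) -> x = y.
Proof.
case: x y => [f fM fN fC] [g gM gN gC] /= /funext fg.
by move: fM fN fC; rewrite fg => *; congr Dual; exact: Prop_irrelevance.
Qed.

Lemma dual_hausdorff (R : realType) (A : topologicalGroupType) :
  hausdorff_space (dual R A).
Proof.
move=> x y xy; apply: dual_ext => a.
apply: (@norm_hausdorff _ (cplx R)) => B C Bx Cy.
have [z [Bz Cz]] := xy _ _ (eval_continuous Bx) (eval_continuous Cy).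
by exists (z a).
Qed.

(** Supports and the pieces of an integral are given as compact open sets,
    while the axioms of a projection valued measure speak of clopen ones. *)
Lemma dual_compact_open_clopen (R : realType) (A : topologicalGroupType)
    (E : set (dual R A)) : compact E -> open E -> clopen E.
Proof.
by move=> cE oE; split=> //; apply: compact_closed => //; exact: dual_hausdorff.
Qed.

(** Composition with [t h^-1] pulls the set of functions sending [K] into [O]
    back to the set of those sending the compact set [t h^-1 @` K] into
    [O]. *)
Lemma dual_act_continuous (R : realType) (H A : topologicalGroupType)
    (t : autAction H A) (h : H) :
  continuous (dual_act t h : dual R A -> dual R A).
Proof.
apply: continuous_comp_initial => x.
apply: (compact_open_cvgP _ (fmap_filter _ (nbhs_filter (x : dual R A)))).2.
move=> K O cK oO /= xKO.
have cK' : compact (t h^-1%g @` K).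
  apply: continuous_compact => //.
  by apply: continuous_subspaceT; exact: aact_continuous_r.
have oS := compact_open_open cK' oO.
have xS : nbhs (dual_fun x : {compact-open, A -> cplx R})
    [set g | g @` (t h^-1%g @` K) `<=` O].
  apply: open_nbhs_nbhs; split; first exact: oS.
  by move=> _ [_ [a Ka <-] <-]; apply: xKO; exists a.
have xS' : nbhs x [set y : dual R A | y @` (t h^-1%g @` K) `<=` O].
  exact: (@initial_continuous _ _
    (fun y : dual R A => dual_fun y : {compact-open, A -> cplx R}) x _ xS).
apply: filterS xS' => y yS _ [a Ka <-] /=.
by apply: yS; exists (t h^-1%g a) => //; exists a.
Qed.

Lemma dual_act_image_clopen (R : realType) (H A : topologicalGroupType)
    (t : autAction H A) (h : H) (E : set (dual R A)) :
  clopen E -> clopen (dual_act t h @` E).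
Proof.
have -> : dual_act t h @` E = dual_act t (h^-1)%g @^-1` E.
  have actK k (x : dual R A) : dual_act t k (dual_act t k^-1%g x) = x.
    by apply: dual_ext => a /=; rewrite invgK -aactM mulgV aact1.
  apply/seteqP; split=> [_ [x Ex <-]|x Ex] /=.
    by have := actK h^-1%g x; rewrite invgK => ->.
  by exists (dual_act t h^-1%g x) => //; rewrite actK.
by move=> /preimage_clopen; apply; exact: dual_act_continuous.
Qed.

(** * Spectral calculus of a smooth representation of A *)

(** The form in which the integral formula is used. The support [F] depends on
    [v] only, which the compactness arguments below require, as they let [a]
    vary. *)
Lemma spectral_decomposition (R : realType) (A : topologicalGroupType)
    (V : lmodType (cplx R)) (pi1 : A -> V -> V) (P : set (dual R A) -> V -> V) :
  corresponding_pvm pi1 P -> forall v, exists2 F, pvm_supported P v F &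
  forall a, exists n (E : 'I_n -> set (dual R A)) (c : 'I_n -> cplx R),
    [/\ forall i, clopen (E i), \bigcup_i E i = F,
        forall i x, E i x -> x a = c i,
        forall S, clopen S -> P S v = \sum_i P (S `&` E i) v
      & pi1 a v = \sum_i c i *: P (E i) v].
Proof.
move=> [pP _ Pint] v; have [F sF int] := Pint v; exists F => // a.
have [n [E [c [cE tE UE fE ->]]]] := int a.
exists n, E, c; have clE i : clopen (E i).
  by have [? ?] := cE i; exact: dual_compact_open_clopen.
split => // S cS; have [cF oF sup] := sF.
have cSF : clopen (\bigcup_i (S `&` E i)).
  rewrite -setI_bigcupr UE; apply: clopenI => //.
  exact: dual_compact_open_clopen.
rewrite sup // -UE setI_bigcupr pvm_finite_additivity //.
- by move=> i; exact: clopenI.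
- exact: trivIset_setIl.
Qed.

(** In the spectral decomposition of [P S v] at [a], a piece that meets [S]
    has value [c], and a piece that does not meet [S] contributes [0]. *)
Lemma rep_pvm_eigen (R : realType) (A : topologicalGroupType)
    (V : lmodType (cplx R)) (pi1 : A -> V -> V) (P : set (dual R A) -> V -> V)
    (a : A) (c : cplx R) (S : set (dual R A)) (v : V) :
  corresponding_pvm pi1 P -> clopen S -> (forall x, S x -> x a = c) ->
  pi1 a (P S v) = c *: P S v.
Proof.
move=> corr cS Sc; have [[Plin PT P0 PI _] _ _] := corr.
have [F _ dec] := spectral_decomposition corr (P S v).
have [n [E [d [cE _ Ed sumE ->]]]] := dec a.
rewrite -[in RHS](PT (P S v)) sumE; last exact: clopenT.
rewrite scaler_sumr; apply: eq_bigr => i _; rewrite setTI !PI //.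
have [[x [Ex Sx]]|/set0P/negP/negPn/eqP ->] := pselect (E i `&` S !=set0).
  by rewrite -(Ed _ _ Ex) Sc.
by rewrite P0 !scaler0.
Qed.

(** Decompose [v] at [a]: both sides become the sum of the eigenvectors
    [P (S `&` E i) v] weighted by the eigenvalues. *)
Lemma rep_pvm_commute (R : realType) (A : topologicalGroupType)
    (V : lmodType (cplx R)) (pi1 : A -> V -> V) (P : set (dual R A) -> V -> V)
    (a : A) (S : set (dual R A)) (v : V) :
  linear (pi1 a) -> corresponding_pvm pi1 P -> clopen S ->
  pi1 a (P S v) = P S (pi1 a v).
Proof.
move=> alin corr cS; have [[Plin PT P0 PI _] _ _] := corr.
have [F _ dec] := spectral_decomposition corr v.
have [n [E [c [cE _ Ec sumE ->]]]] := dec a.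
have [g gE] := linear_bundle alin.
have [p pE] := linear_bundle (Plin S cS).
rewrite sumE // gE linear_sum pE linear_sum; apply: eq_bigr => i _.
rewrite linearZ -gE -pE /= PI //.
by apply: rep_pvm_eigen => //; [exact: clopenI|move=> x [_ /Ec]].
Qed.

(** [P S] preserves the eigenspaces of [pi1 a], while its range lies in the
    one of eigenvalue [c]. *)
Lemma pvm_vanish_eigenvector (R : realType) (A : topologicalGroupType)
    (V : lmodType (cplx R)) (pi1 : A -> V -> V) (P : set (dual R A) -> V -> V)
    (a : A) (c d : cplx R) (S : set (dual R A)) (v : V) :
  linear (pi1 a) -> corresponding_pvm pi1 P -> clopen S ->
  (forall x, S x -> x a = c) -> pi1 a v = d *: v -> c != d -> P S v = 0.
Proof.
move=> alin corr cS Sc av cd; have [[Plin _ _ _ _] _ _] := corr.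
have := rep_pvm_commute v alin corr cS.
rewrite (rep_pvm_eigen _ corr cS Sc) av.
have [p ->] := linear_bundle (Plin S cS).
rewrite linearZ => /eqP; rewrite -subr_eq0 -scalerBl scaler_eq0 subr_eq0.
by rewrite (negPf cd) => /eqP.
Qed.

(** * Intertwiners respect the spectral decomposition *)

(** The last hypothesis says that no character in [D] pulls back along [s] to
    a character in [E]. Two nested compactness arguments, over [y] in [D] and
    then over [x] in [E], reduce the claim to small neighbourhoods of [y] and
    [x]. On these, for an element [a] separating [x] from [y], the vector
    [T (P S v)], with [S] the neighbourhood of [x], is an eigenvector of
    [rho (s a)] whose eigenvalue [x a] differs from [y (s a)]; so [Q] of the
    neighbourhood of [y] kills it. *)
Lemma intertwiner_disjoint (R : realType) (A B : topologicalGroupType)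
    (V W : lmodType (cplx R))
    (pi1 : A -> V -> V) (P : set (dual R A) -> V -> V)
    (rho : B -> W -> W) (Q : set (dual R B) -> W -> W)
    (s : A -> B) (T : V -> W) (E : set (dual R A)) (D : set (dual R B)) :
  (forall b, linear (rho b)) ->
  corresponding_pvm pi1 P -> corresponding_pvm rho Q ->
  linear T -> (forall a v, T (pi1 a v) = rho (s a) (T v)) ->
  clopen E -> clopen D ->
  (forall x y, E x -> D y -> exists a, x a != y (s a)) ->
  forall v, Q D (T (P E v)) = 0.
Proof.
move=> rholin corrP corrQ Tlin TE cE cD sep v.
have [pP _ _] := corrP; have [qP _ _] := corrQ.
have [L LE] := linear_bundle Tlin.
set w := T (P E v).
have [Fw [kFw oFw supw] decw] := spectral_decomposition corrQ w.
have [Fv [kFv oFv supv] decv] := spectral_decomposition corrP v.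
have cFw := dual_compact_open_clopen kFw oFw.
have cFv := dual_compact_open_clopen kFv oFv.
rewrite supw //.
suff [N [cN QN] DN] : exists2 N, clopen N /\ Q N w = 0 & D `&` Fw `<=` N.
  by apply: (pvm_vanishS qP _ cN DN QN); exact: clopenI.
apply: compact_cover_ind.
- by rewrite setIC; apply: compact_closedI => //; exact: cD.2.
- by split; [exact: clopen0|case: qP].
- move=> M N [cM QM] [cN QN]; split; first exact: clopenU.
  exact: pvm_vanishU.
move=> y [Dy Fwy].
(* The vanishing is required for all the clopen subsets [S] of [N], because
   vanishing at [P N v] does not pass to smaller [N]. *)
pose good N M := forall S, clopen S -> S `<=` N -> Q M (T (P S v)) = 0.
suff [N [cN [M [cM My gNM]]] EN] :
    exists2 N, clopen N /\ exists M, [/\ clopen M, M y & good N M]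
             & E `&` Fv `<=` N.
  exists M; last by apply: open_nbhs_nbhs; split => //; exact: cM.1.
  split => //; rewrite /w supv //; apply: gNM => //; exact: clopenI.
apply: compact_cover_ind.
- by rewrite setIC; apply: compact_closedI => //; exact: cE.2.
- split; first exact: clopen0.
  exists setT; split => // [|S cS]; first exact: clopenT.
  rewrite subset0 => ->.
  case: pP => _ _ -> _ _; rewrite LE linear0.
  by case: qP => /(_ _ clopenT)/linear_bundle[q ->]; rewrite linear0.
- move=> N1 N2 [c1 [M1 [cM1 M1y g1]]] [c2 [M2 [cM2 M2y g2]]].
  split; first exact: clopenU.
  exists (M1 `&` M2); split => // [|S cS SN]; first exact: clopenI.
  have cM := clopenI cM1 cM2.
  have [q qE] : exists q : {linear W -> W}, Q (M1 `&` M2) = q.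
    by case: qP => /(_ _ cM)/linear_bundle.
  rewrite (pvm_setID v pP cS c1) LE linearD -LE qE linearD -qE.
  have S1 : S `&` N1 `<=` N1 by move=> ? [].
  have S2 : S `\` N1 `<=` N2 by move=> z [/SN[]].
  rewrite (pvm_vanishS qP cM cM1 (@subIsetl _ _ _) (g1 _ (clopenI cS c1) S1)).
  rewrite (pvm_vanishS qP cM cM2 (@subIsetr _ _ _) (g2 _ (clopenD cS c1) S2)).
  by rewrite addr0.
(* The piece around [y] is taken from the decomposition of [w], which depends on
   neither [x] nor [N]; hence one support [Fw] serves for all [x]. *)
move=> x [Ex Fvx]; have [a xay] := sep _ _ Ex Dy.
have [n [Ev [cv [cEv UEv Evc _ _]]]] := decv a.
have [m [Ew [cw [cEw UEw Ewc _ _]]]] := decw (s a).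
have [i _ xi] : (\bigcup_i Ev i) x by rewrite UEv.
have [j _ yj] : (\bigcup_j Ew j) y by rewrite UEw.
exists (Ev i); last by apply: open_nbhs_nbhs; split => //; exact: (cEv i).1.
split => //; exists (Ew j); split => // S cS SE.
apply: (pvm_vanish_eigenvector (a := s a) (c := cw j) (d := cv i)) => //.
- exact: Ewc.
- rewrite -TE (rep_pvm_eigen (c := cv i) v corrP cS); last by move=> z /SE/Evc.
  by rewrite LE linearZ.
- by rewrite -(Ewc _ _ yj) -(Evc _ _ xi) eq_sym.
Qed.

(** * Compact open subgroups *)

Lemma lcoset_nbhs (G : topologicalGroupType) (K : set G) (x : G) :
  nbhs 1%g K -> nbhs x [set y | K (x^-1 * y)%g].
Proof.
move=> K1; have cx : {for x, continuous (fun y : G => (x^-1 * y)%g)}.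
  apply: (@continuous_comp _ _ _ (fun y => (x^-1%g, y))
    (fun xy : G * G => (xy.1 * xy.2)%g)); last exact: mulg_continuous.
  by apply: cvg_pair; [exact: cvg_cst|exact: cvg_id].
by apply: cx; rewrite /= mulVg.
Qed.

(** Left cosets of [K] are neighbourhoods of their points: a point of [K], or
    of its closure, has such a coset around it that lies in, or meets, [K]. *)
Lemma subgroup_clopen (G : topologicalGroupType) (K : set G) :
  is_subgroup K -> nbhs 1%g K -> clopen K.
Proof.
move=> [_ KM KV] K1; split.
  rewrite openE => x Kx; apply: filterS (lcoset_nbhs x K1) => y /= Ky.
  by rewrite -(mulVKg x y); exact: KM.
move=> x /(_ _ (lcoset_nbhs x K1))[y [Ky Kxy]].
have -> : x = (y * (x^-1 * y)^-1)%g by rewrite invgM invgK mulVKg.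
by apply: KM => //; exact: KV.
Qed.

(** [K `*` L] need not be a subgroup, as [K] need not preserve [L]. The
    elements of [K] that preserve [L] and whose inverses preserve [L] form a
    subgroup [N], which contains a neighbourhood of [1] because [L] is
    compact; so [N] is clopen, hence compact, and [N `*` L] is the
    subgroup. *)
Lemma semidirect_compact_open_subgroup (H A : topologicalGroupType)
    (t : autAction H A) (K : set H) (L : set A) :
  is_subgroup K -> compact K -> open K ->
  is_subgroup L -> compact L -> open L ->
  exists M : set (semidirect t), [/\ is_subgroup M, compact M, open M
    & M `<=` [set x | K x.1 /\ L x.2]].
Proof.
move=> sK kK oK sL kL oL; have [K1 KM KV] := sK; have [L1 LM LV] := sL.
pose S := [set h | forall a, L a -> L (t h a)].
pose N := [set h | [/\ K h, S h & S h^-1%g]].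
have sN : is_subgroup N.
  have S1 : S 1%g by move=> a; rewrite aact1.
  have SM h k : S h -> S k -> S (h * k)%g.
    by move=> Sh Sk a La; rewrite aactM; apply/Sh/Sk.
  split.
  - by split; rewrite ?invg1.
  - move=> h k [Kh Sh Sh'] [Kk Sk Sk']; split; [exact: KM|exact: SM|].
    by rewrite invgM; exact: SM.
  - by move=> h [Kh Sh Sh']; split; rewrite ?invgK //; exact: KV.
have nS : nbhs 1%g S.
  move/compact_near_coveringP: kL => /(_ _ (nbhs (1%g : H))
    (fun h a => L (t h a))); apply => a La.
  have : nbhs (t 1%g a) L by apply: open_nbhs_nbhs; split=> //; rewrite aact1.
  move/(@aact_continuous _ _ t (1%g, a)) => [[U1 U2] /= [U1n U2n] U12].
  exists (U2, U1) => // -[b h] /= [U2b U1h].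
  exact: (U12 (h, b)).
have nN : nbhs 1%g N.
  have nK : nbhs 1%g K by apply: open_nbhs_nbhs.
  have nS' : nbhs 1%g [set h : H | S h^-1%g].
    by apply: (@invg_continuous H 1%g); rewrite invg1.
  by apply: filterS (filterI nK (filterI nS nS')) => h [? []].
have [oN cN] := subgroup_clopen sN nN.
have kN : compact N by apply: (subclosed_compact cN kK) => h [].
exists [set x | N x.1 /\ L x.2]; have [N1 NM NV] := sN; split.
- split; first by split.
  + move=> x y [Nx Lx] [Ny Ly]; split; first exact: NM.
    by apply: LM => //; case: Nx => _ Sx _; exact: Sx.
  + move=> x [Nx Lx]; split; first exact: NV.
    by case: Nx => _ _ Sx; apply/Sx/LV.
- exact: (compact_setX kN kL).
- rewrite openE => -[h a] [Nh La]; exists (N, L) => //=.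
  by split; apply: open_nbhs_nbhs.
- by move=> x [[Kx _ _] Lx].
Qed.

(** * Extensions and systems of imprimitivity *)

(** By [intertwiner_disjoint], [pi2 h] maps the range of [P E] into the range
    of [P (h E)], and the same for the complements; since [P E] and [P (h E)]
    each split [V] into range and kernel, this determines the conjugate of
    [P E]. *)
Lemma intertwining_imprimitivity (R : realType) (A H : topologicalGroupType)
    (t : autAction H A) (V : lmodType (cplx R))
    (pi1 : A -> V -> V) (pi2 : H -> V -> V) (P : set (dual R A) -> V -> V) :
  is_rep pi1 -> is_rep pi2 -> corresponding_pvm pi1 P ->
  (forall h a v, pi2 h (pi1 a v) = pi1 (t h a) (pi2 h v)) ->
  forall h E v, clopen E ->
    pi2 h (P E (pi2 (h^-1)%g v)) = P (dual_act t h @` E) v.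
Proof.
move=> [lin1 _ _] [lin2 pi2_1 pi2M] corr inter h E v cE.
have [pP _ _] := corr; have [Plin PT _ _ _] := pP.
set hE := dual_act t h @` E; have chE : clopen hE.
  exact: dual_act_image_clopen.
have v_eq : v = pi2 h (pi2 h^-1%g v) by rewrite -pi2M mulgV pi2_1.
set u := pi2 h^-1%g v in v_eq *.
have disj D S : clopen D -> clopen S ->
    (forall x y, S x -> D y -> y <> dual_act t h x) -> P D (pi2 h (P S u)) = 0.
  move=> cD cS DS; apply: (intertwiner_disjoint lin1 corr corr (lin2 h)
    (inter h) cS cD) => x y Sx Dy.
  apply: contrapT => noa; apply: (DS x y Sx Dy); apply: dual_ext => a /=.
  have /negP := (forallNP _).2 noa (t h^-1%g a).
  by rewrite negbK -aactM mulgV aact1 => /eqP.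
have [p pE] := linear_bundle (Plin _ chE).
have [g gE] := linear_bundle (lin2 h).
rewrite -(PT (pi2 h (P E u))) (pvm_setID _ pP clopenT chE) setTI setTD.
rewrite (disj (~` hE) E) ?addr0 //; last 2 first.
- exact: clopenC.
- by move=> x y Ex hEy xy; apply: hEy; exists x.
rewrite [in RHS]v_eq -[in RHS](PT u) (pvm_setID _ pP clopenT cE) setTI setTD.
rewrite gE linearD -gE pE linearD -pE (disj hE (~` E)) ?addr0 //.
- exact: clopenC.
- move=> x y nEx [z Ez <-] zx; apply: nEx; rewrite (_ : x = z) //.
  apply: dual_ext => a.
  have := congr1 (fun y : dual R A => y (t h a)) zx.
  by rewrite /= -aactM mulVg aact1.
Qed.

(** On each piece [E i] of the decomposition of [v] at [a], both sides are
    [c i *: pi2 h (P (E i) v)]: the characters in [h (E i)] take at [t h a]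
    the value [c i]. *)
Lemma imprimitivity_intertwines (R : realType) (A H : topologicalGroupType)
    (t : autAction H A) (V : lmodType (cplx R))
    (pi1 : A -> V -> V) (pi2 : H -> V -> V) (P : set (dual R A) -> V -> V) :
  is_rep pi1 -> corresponding_pvm pi1 P -> cosmooth_imprimitivity t pi2 P ->
  forall h a v, pi2 h (pi1 a v) = pi1 (t h a) (pi2 h v).
Proof.
move=> [lin1 _ _] corr [[[lin2 pi2_1 pi2M] _] [_ PT _ _ _] _ cov] h a v.
have [F _ dec] := spectral_decomposition corr v.
have [n [E [c [cE _ Ec sumE ->]]]] := dec a.
have [f fE] := linear_bundle (lin1 (t h a)).
have [g gE] := linear_bundle (lin2 h).
rewrite -[in RHS](PT v) sumE; last exact: clopenT.
rewrite gE !linear_sum fE linear_sum; apply: eq_bigr => i _.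
rewrite setTI linearZ -gE -fE.
have -> : pi2 h (P (E i) v) = P (dual_act t h @` E i) (pi2 h v).
  by rewrite -cov // -pi2M mulVg pi2_1.
rewrite (rep_pvm_eigen (c := c i) _ corr) //; first exact: dual_act_image_clopen.
by move=> _ [x Ex <-] /=; rewrite -aactM mulVg aact1; exact: Ec.
Qed.

(** The relation is exactly what makes [pi1 a \o pi2 h] multiplicative. *)
Lemma intertwining_extension (R : realType) (A H : topologicalGroupType)
    (t : autAction H A) (V : lmodType (cplx R))
    (pi1 : A -> V -> V) (pi2 : H -> V -> V) :
  smooth_rep pi1 -> smooth_rep pi2 ->
  (forall h a v, pi2 h (pi1 a v) = pi1 (t h a) (pi2 h v)) ->
  smooth_extension pi1 pi2 (fun x : semidirect t => pi1 x.2 \o pi2 x.1).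
Proof.
move=> [[lin1 pi1_1 pi1M] sm1] [[lin2 pi2_1 pi2M] sm2] inter; split.
- split.
    split => [x|v|x y v] /=.
    + have [f ->] := linear_bundle (lin1 x.2).
      have [g ->] := linear_bundle (lin2 x.1).
      by move=> k u v /=; rewrite !linearP.
    + by rewrite pi2_1 pi1_1.
    + by rewrite pi1M pi2M inter.
  move=> v; have [K [sK kK oK Kv]] := sm2 v; have [L [sL kL oL Lv]] := sm1 v.
  have [M [sM kM oM MKL]] :=
    semidirect_compact_open_subgroup t sK kK oK sL kL oL.
  by exists M; split => // x /MKL[Kx Lx] /=; rewrite Kv // Lv.
- by move=> a; apply/funext => v /=; rewrite pi2_1.
- by move=> h; apply/funext => v /=; rewrite pi1_1.
Qed.

Lemma semidirect_factor (H A : topologicalGroupType) (t : autAction H A)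
    (x : semidirect t) :
  (x = semidirect_inr t x.2 * semidirect_inl t x.1)%g.
Proof.
case: x => h a; rewrite -[RHS]/(((1 * h)%g, (a * t 1 1)%g)).
by rewrite mul1g aact1 mulg1.
Qed.

(** In the semidirect product, [h * a = t h a * h]. *)
Lemma smooth_extension_intertwines (R : realType) (A H : topologicalGroupType)
    (t : autAction H A) (V : lmodType (cplx R)) (pi1 : A -> V -> V)
    (pi2 : H -> V -> V) (pi : semidirect t -> V -> V) :
  smooth_extension pi1 pi2 pi ->
  forall h a v, pi2 h (pi1 a v) = pi1 (t h a) (pi2 h v).
Proof.
move=> [[[_ _ piM] _] pi_inr pi_inl] h a v.
rewrite -pi_inl -!pi_inr -!piM; congr (pi _ v).
rewrite -[LHS]/((h * 1)%g, (1 * t h a)%g).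
by rewrite -[RHS]/((1 * h)%g, (t h a * t 1 1)%g) aact1 !mulg1 !mul1g.
Qed.

Lemma smooth_extension_unique (R : realType) (A H : topologicalGroupType)
    (t : autAction H A) (V : lmodType (cplx R)) (pi1 : A -> V -> V)
    (pi2 : H -> V -> V) (pi rho : semidirect t -> V -> V) :
  smooth_extension pi1 pi2 pi -> smooth_extension pi1 pi2 rho -> pi = rho.
Proof.
move=> [[[_ _ piM] _] pi_inr pi_inl] [[[_ _ rhoM] _] rho_inr rho_inl].
apply/funext => x; apply/funext => v.
by rewrite (semidirect_factor x) piM rhoM pi_inr pi_inl rho_inr rho_inl.
Qed.

Theorem lemma1 (R : realType) (A H : topologicalGroupType)
    (t : autAction H A) (V : lmodType (cplx R))
    (A_abelian : forall a b : A, (a * b = b * a)%g)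
    (A_lc : locally_compact [set: A]) (A_td : totally_disconnected [set: A])
    (dualA_lc : locally_compact [set: dual R A])
    (dualA_td : totally_disconnected [set: dual R A])
    (H_lc : locally_compact [set: H]) (H_td : totally_disconnected [set: H])
    (pi1 : A -> V -> V) (pi2 : H -> V -> V) (P : set (dual R A) -> V -> V)
    (pi1_smooth : smooth_rep pi1) (pi2_smooth : smooth_rep pi2)
    (P_pi1 : corresponding_pvm pi1 P) :
  ((exists pi : semidirect t -> V -> V, smooth_extension pi1 pi2 pi) <->
     cosmooth_imprimitivity t pi2 P) /\
  (cosmooth_imprimitivity t pi2 P ->
     exists! pi : semidirect t -> V -> V, smooth_extension pi1 pi2 pi).

Proof.
have [rep1 _] := pi1_smooth; have [rep2 _] := pi2_smooth.
have [pP cosm _] := P_pi1.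
have ext : cosmooth_imprimitivity t pi2 P ->
    smooth_extension pi1 pi2 (fun x : semidirect t => pi1 x.2 \o pi2 x.1).
  move=> imp; apply: intertwining_extension => //.
  exact: imprimitivity_intertwines rep1 P_pi1 imp.
split; last first.
  move=> /ext; set pi := (X in smooth_extension _ _ X) => epi.
  by exists pi; split => // rho; exact: smooth_extension_unique.
split=> [[pi epi]|/ext epi]; last by eexists; exact: epi.
split => //; apply: (intertwining_imprimitivity rep1 rep2 P_pi1).
exact: smooth_extension_intertwines epi.
Qed.
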